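(* Let $M$ be a monitor. (a) If $M$ is observationally sound, then $M$ is sound. (b) If $M$ is complete, then $M$ is observationally complete.
   Context: Setting. MTL$^{\downarrow}$ is metric temporal logic extended with a freeze quantifier ${\downarrow^r}x$ (binding variable $x$ to the current value of register $r$), with connectives $\mathsf{t}$, $p(\bar x)$, $\neg$, $\vee$, previous $\bullet_I$, next $\circ_I$, $\mathsf{S}_I$, $\mathsf{U}_I$ ($I$ an interval of $\mathbb{Q}_{\geq0}$). Truth values $\{\mathsf{t},\mathsf{f},\bot\}$ with knowledge order $\bot\prec\mathsf{t}$, $\bot\prec\mathsf{f}$; this is a lower semilattice. Observations are finite words of letters $(I,(\sigma,\rho))$ with $I$ an interval and $\sigma,\rho$ partial interpretations of predicates and registers; the initial observation is $w_0=([0,\infty),(\text{undefined},\text{undefined}))$ and refinements $w\sqsubseteq w'$ arise by (T1) splitting a nonsingleton interval at a point $\tau$ into $[\cdot,\tau)$, $\{\tau\}$, $(\tau,\cdot]$ parts, (T2) removing a bounded nonsingleton letter, (T3) extending the partial maps at a singleton letter. A timed word $v$ (infinite, total interpretations, strictly increasing nonzeno timestamps $\tau_j$) refines an observation $w$ if every letter $(\tau_j,(\sigma'_j,\rho'_j))$ of $v$ has some letter $(I_i,(\sigma_i,\rho_i))$ of $w$ with $\tau_j\in I_i$, $\sigma_i\sqsubseteq\sigma'_j$, $\rho_i\sqsubseteq\rho'_j$. Let $U_w$ be the set of timed words refining $w$. $[\![\phi]\!]^{\tau}_{w,\nu}$ denotes the three-valued (Kleene-style) semantics of $\phi$ on observation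 $w$ at the time point with timestamp $\tau$ under partial valuation $\nu$ ($\bot$ if there is no such time point); $[\![\phi]\!]^{\mathrm{B},\tau}_{v,\nu}$ denotes the standard Boolean semantics on timed word $v$ at the position with timestamp $\tau$ under total valuation $\nu$ ($\bot$ if no such position). Fact used: if $w\sqsubseteq v$ (observation $w$, timed word $v$) and $\mu\sqsubseteq\nu$ then $[\![\phi]\!]^{\tau}_{w,\mu}\preceq[\![\phi]\!]^{\mathrm{B},\tau}_{v,\nu}$. A sequence $\bar w=(w_i)_{i\in\mathbb{N}}$ of observations is valid if $w_0$ is the initial observation and $w_i\sqsubseteq w_{i+1}$, $w_i\neq w_{i+1}$ for all $i$. A monitor outputs at each iteration $i$ a finite verdict set $V_i\subseteq\mathbb{Q}_{\geq0}\times\{\mathsf{t},\mathsf{f}\}$. For a closed formula $\phi$, valid $\bar w$, and $\bar V=(V_i)$: $\bar V$ is observationally sound if for all partial valuations $\nu$ and $i$, $(\tau,b)\in V_i$ implies $[\![\phi]\!]^{\tau}_{w_i,\nu}=b$; observationally complete if for all partial $\nu$, $i$, $\tau$, $[\![\phi]\!]^{\tau}_{w_i,\nu}\in\{\mathsf{t},\mathsf{f}\}$ implies $(\tau,b)\in\bigcup_{j\le i}V_j$ for some $b\in\{\mathsf{t},\mathsf{f}\}$; sound if for all total valuations $\nu$ and $i$, $(\tau,b)\in V_i$ implies that the meet (greatest lower bound w.r.t. $\prec$) of $\{[\![\phi]\!]^{\mathrm{B},\tau}_{v,\nu}\mid v\in U_{w_i}\}$ equals $b$; complete if for all total $\nu$,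 $i$, $\tau$, whenever that meet is in $\{\mathsf{t},\mathsf{f}\}$ then $(\tau,b)\in\bigcup_{j\le i}V_j$ for some $b$. A monitor is (observationally) sound/complete if its verdict sequence has that property for every valid $\bar w$ and closed $\phi$.
   Formalization: A timed word refining an observation w is additionally required to have a timestamp at every singleton letter {τ} of w (otherwise the stated Fact and both claims fail, as the meet is always ⊥); the data domain is assumed nonempty. *)

(* Defs.v *)
From HB Require Import structures.
From Stdlib Require Import Relation_Operators.
From mathcomp Require Import all_boot all_order all_algebra.
From mathcomp Require Import boolp classical_sets cardinality.

Set Implicit Arguments.
Unset Strict Implicit.
Unset Printing Implicit Defensive.

Import Order.TTheory GRing.Theory Num.Theory.
Local Open Scope classical_set_scope.
Local Open Scope ring_scope.

(* [Some true], [Some false] and [None] stand for t, f and bottom. *)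
Definition tv : Type := option bool.
HB.instance Definition _ := Choice.on tv.

Definition tv_le (x y : tv) : bool := (x == None) || (x == y).

Fact tv_le_refl : reflexive tv_le.
Proof. by move=> x; rewrite /tv_le eqxx orbT. Qed.

Fact tv_le_anti : antisymmetric tv_le.
Proof. by move=> [[]|] [[]|]. Qed.

Fact tv_le_trans : transitive tv_le.
Proof. by move=> [[]|] [[]|] [[]|]. Qed.

Fact tv_display : Order.disp_t. Proof. exact: Order.Disp tt tt. Qed.

(* The knowledge order: bottom lies below the two incomparable Booleans.  A set
   of truth values therefore has at most one element in [infimums], and the
   empty set has none. *)
HB.instance Definition _ :=
  Order.Le_isPOrder.Build tv_display tv tv_le_refl tv_le_anti tv_le_trans.

Definition tv_not (x : tv) : tv := omap negb x.

Definition tv_or (x y : tv) : tv :=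
  match x, y with
  | Some true, _ | _, Some true => Some true
  | Some false, Some false => Some false
  | _, _ => None
  end.

Definition tv_and (x y : tv) : tv := tv_not (tv_or (tv_not x) (tv_not y)).

Definition tv_imp (x y : tv) : tv := tv_or (tv_not x) y.

Definition pext (A : Type) (B : A -> Type) (f g : forall a, option (B a)) : Prop :=
  forall a b, f a = Some b -> g a = Some b.

Definition total (A : Type) (B : A -> Type) (f : forall a, B a) :
  forall a, option (B a) := fun a => Some (f a).

Definition undefined (A : Type) (B : A -> Type) : forall a, option (B a) :=
  fun _ => None.

Definition update (X : eqType) (Y : Type) (f : X -> Y) (x : X) (y : Y) : X -> Y :=
  fun z => if z == x then y else f z.

Record itvQ := ItvQ {
  itv_set :> rat -> Prop;
  itv_nonempty : exists x, itv_set x;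
  itv_ge0 : forall x, itv_set x -> 0 <= x;
  itv_convex : forall x y, itv_set x -> itv_set y ->
    forall z, x <= z <= y -> itv_set z
}.

Definition singleton (A : set rat) : Prop := exists x, A = [set x].

Section Logic.

Variables (P : Type) (ar : P -> nat) (Reg : Type) (X : eqType) (D : Type).

Inductive formula : Type :=
| FTrue
| FPred (p : P) (xs : (ar p).-tuple X)
| FFreeze (r : Reg) (x : X) (phi : formula)
| FNot (phi : formula)
| FOr (phi psi : formula)
| FPrev (J : itvQ) (phi : formula)
| FNext (J : itvQ) (phi : formula)
| FSince (J : itvQ) (phi psi : formula)
| FUntil (J : itvQ) (phi psi : formula).

Fixpoint fv (phi : formula) : seq X :=
  match phi with
  | FTrue => [::]
  | FPred _ xs => xs
  | FFreeze _ x phi => [seq y <- fv phi | y != x]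
  | FNot phi | FPrev _ phi | FNext _ phi => fv phi
  | FOr phi psi | FSince _ phi psi | FUntil _ phi psi => fv phi ++ fv psi
  end.

Definition closed (phi : formula) : Prop := fv phi = [::].

Definition pinterp : Type := forall p : P, option (set ((ar p).-tuple D)).

Record letter := Letter {
  ltime : set rat;
  lpred : pinterp;
  lreg : Reg -> option D
}.

Definition initial : seq letter :=
  [:: Letter [set x | 0 <= x] (undefined _) (undefined _)].

(* The parts into which [l] is split at [t].  Empty parts are dropped, so that
   splitting [0, b) at 0 yields {0} and (0, b). *)
Definition split_letter (l : letter) (t : rat) : seq letter :=
  [seq Letter A (lpred l) (lreg l) |
    A <- [:: ltime l `&` [set x | x < t]; [set t]; ltime l `&` [set x | t < x]]
    & `[< A !=set0 >]].

Inductive step : seq letter -> seq letter -> Prop :=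
| step_split w1 l w2 t of ~ singleton (ltime l) & ltime l t :
    step (w1 ++ l :: w2) (w1 ++ split_letter l t ++ w2)
| step_remove w1 l w2 of ~ singleton (ltime l) & has_ubound (ltime l) :
    step (w1 ++ l :: w2) (w1 ++ w2)
| step_extend w1 A s r s' r' w2 of singleton A & pext s s' & pext r r' :
    step (w1 ++ Letter A s r :: w2) (w1 ++ Letter A s' r' :: w2).

Definition refines : seq letter -> seq letter -> Prop :=
  clos_refl_trans (seq letter) step.

(* All words of a valid sequence are reachable from [initial]; hence their
   letters carry pairwise disjoint, increasingly ordered intervals. *)
Definition valid (ws : nat -> seq letter) : Prop :=
  ws 0%N = initial /\
  forall i, refines (ws i) (ws i.+1) /\ ws i <> ws i.+1.

Record tword := TWord {
  ts : nat -> rat;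
  tpred : nat -> forall p, set ((ar p).-tuple D);
  treg : nat -> Reg -> D;
  ts_ge0 : forall j, 0 <= ts j;
  ts_incr : forall j, ts j < ts j.+1;
  ts_nonzeno : forall x, exists j, x < ts j
}.

(* A letter whose interval is a singleton {t} records that t is known to be a
   timestamp, which is how [tp] below treats it; the second conjunct says that
   [v] agrees.  Without it a timed word could skip t, and the three-valued
   semantics would not approximate the Boolean one. *)
Definition trefines (w : seq letter) (v : tword) : Prop :=
  (forall j, exists i : 'I_(size w),
     let l := tnth (in_tuple w) i in
     [/\ ltime l (ts v j), pext (lpred l) (total (tpred v j))
       & pext (lreg l) (total (treg v j))]) /\
  (forall (i : 'I_(size w)) t, ltime (tnth (in_tuple w) i) = [set t] ->
     exists j, ts v j = t).

Definition twords_of (w : seq letter) : set tword := [set v | trefines w v].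

Fixpoint bsem (v : tword) (nu : X -> D) (i : nat) (phi : formula) : Prop :=
  match phi with
  | FTrue => True
  | FPred p xs => tpred v i (map_tuple nu xs)
  | FFreeze r x phi => bsem v (update nu x (treg v i r)) i phi
  | FNot phi => ~ bsem v nu i phi
  | FOr phi psi => bsem v nu i phi \/ bsem v nu i psi
  | FPrev J phi =>
      (0 < i)%N /\ J (ts v i - ts v i.-1) /\ bsem v nu i.-1 phi
  | FNext J phi =>
      J (ts v i.+1 - ts v i) /\ bsem v nu i.+1 phi
  | FSince J phi psi => exists j, [/\ (j <= i)%N, J (ts v i - ts v j),
      bsem v nu j psi & forall k, (j < k <= i)%N -> bsem v nu k phi]
  | FUntil J phi psi => exists j, [/\ (i <= j)%N, J (ts v j - ts v i),
      bsem v nu j psi & forall k, (i <= k < j)%N -> bsem v nu k phi]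
  end.

Definition bval (v : tword) (nu : X -> D) (t : rat) (phi : formula) : tv :=
  match pselect (exists i, ts v i = t) with
  | left ex => Some `[< bsem v nu (projT1 (cid ex)) phi >]
  | right _ => None
  end.

Section Kleene.

Variable w : seq letter.

Let time (i : 'I_(size w)) : set rat := ltime (tnth (in_tuple w) i).

(* Truth value of "letter [i] contains a time point": a nonsingleton letter may
   still be removed. *)
Definition tp (i : 'I_(size w)) : tv :=
  if `[< singleton (time i) >] then Some true else None.

(* Truth value of "[x - y] is in [J]" for the time points [x] of letter [i] and
   [y] of letter [j]. *)
Definition tc (J : itvQ) (i j : 'I_(size w)) : tv :=
  if `[< forall x y, time i x -> time j y -> J (x - y) >] then Some true
  else if `[< forall x y, time i x -> time j y -> ~ J (x - y) >] then Some false
  else None.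

(* A nonsingleton letter may contain several time points in either order. *)
Definition before (i j : 'I_(size w)) : tv :=
  if (i < j)%N then Some true
  else if (i == j) && ~~ `[< singleton (time i) >] then None
  else Some false.

(* Truth value of "no time point lies between those of letters [i] and [j]". *)
Definition adjacent (i j : 'I_(size w)) : tv :=
  \big[tv_and/Some true]_(k < size w)
    tv_not (tv_and (tp k) (tv_and (before i k) (before k j))).

Definition ptuple (nu : X -> option D) n (xs : n.-tuple X) : option (n.-tuple D) :=
  match pselect (exists ds : n.-tuple D,
                   forall k, nu (tnth xs k) = Some (tnth ds k)) with
  | left ex => Some (projT1 (cid ex))
  | right _ => None
  end.

(* Each clause is the Kleene reading of the Boolean one.  The previous time point
   is the earlier one with no time point in between, and dually for next; the
   result is unknown where a nonsingleton neighbour leaves it undecided. *)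
Fixpoint osem (nu : X -> option D) (i : 'I_(size w)) (phi : formula) : tv :=
  match phi with
  | FTrue => Some true
  | FPred p xs =>
      match lpred (tnth (in_tuple w) i) p, ptuple nu xs with
      | Some A, Some ds => Some `[< A ds >]
      | _, _ => None
      end
  | FFreeze r x phi =>
      osem (update nu x (lreg (tnth (in_tuple w) i) r)) i phi
  | FNot phi => tv_not (osem nu i phi)
  | FOr phi psi => tv_or (osem nu i phi) (osem nu i psi)
  | FPrev J phi =>
      \big[tv_or/Some false]_(j < size w)
        tv_and (tp j) (tv_and (before j i) (tv_and (adjacent j i)
          (tv_and (tc J i j) (osem nu j phi))))
  | FNext J phi =>
      \big[tv_or/Some false]_(j < size w)
        tv_and (tp j) (tv_and (before i j) (tv_and (adjacent i j)
          (tv_and (tc J j i) (osem nu j phi))))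
  | FSince J phi psi =>
      \big[tv_or/Some false]_(j < size w | (j <= i)%N)
        tv_and (tp j) (tv_and (tc J i j) (tv_and (osem nu j psi)
          (\big[tv_and/Some true]_(k < size w | (j < k <= i)%N)
             tv_imp (tp k) (osem nu k phi))))
  | FUntil J phi psi =>
      \big[tv_or/Some false]_(j < size w | (i <= j)%N)
        tv_and (tp j) (tv_and (tc J j i) (tv_and (osem nu j psi)
          (\big[tv_and/Some true]_(k < size w | (i <= k < j)%N)
             tv_imp (tp k) (osem nu k phi))))
  end.

Definition oval (nu : X -> option D) (t : rat) (phi : formula) : tv :=
  if [pick i | `[< time i = [set t] >]] is Some i then osem nu i phi else None.

End Kleene.

Record monitor := Monitor {
  verdicts :> formula -> (nat -> seq letter) -> nat -> set (rat * bool);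
  verdicts_finite : forall phi ws i, finite_set (verdicts phi ws i);
  verdicts_ge0 : forall phi ws i tb, verdicts phi ws i tb -> 0 <= tb.1
}.

Section Verdicts.

Variables (phi : formula) (ws : nat -> seq letter) (V : nat -> set (rat * bool)).

Definition obs_sound : Prop := forall (nu : X -> option D) i t b,
  V i (t, b) -> oval (ws i) nu t phi = Some b.

Definition obs_complete : Prop := forall (nu : X -> option D) i t, 0 <= t ->
  (exists c, oval (ws i) nu t phi = Some c) ->
  exists b, (\bigcup_(j in [set j | (j <= i)%N]) V j) (t, b).

Definition sound : Prop := forall (nu : X -> D) i t b,
  V i (t, b) ->
  infimums [set bval v nu t phi | v in twords_of (ws i)] (Some b).

Definition complete : Prop := forall (nu : X -> D) i t, 0 <= t ->
  (exists c, infimums [set bval v nu t phi | v in twords_of (ws i)] (Some c)) ->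
  exists b, (\bigcup_(j in [set j | (j <= i)%N]) V j) (t, b).

End Verdicts.

Definition monitor_has
    (prop : formula -> (nat -> seq letter) -> (nat -> set (rat * bool)) -> Prop)
    (M : monitor) : Prop :=
  forall phi ws, closed phi -> valid ws -> prop phi ws (M phi ws).

End Logic.

(* Main.v *)
(** An observation [w] approximates every timed word refining it: a definite
    three-valued verdict is the Boolean verdict on all of them, under every total
    extension of the valuation.  Some timed word refines [w]: it takes exactly the
    timestamps recorded by singleton letters and continues in the unbounded letter,
    which no refinement step removes.  Hence a definite observational verdict is
    the meet of a nonempty set containing nothing else, and both claims follow. *)
Require Import Defs.
From mathcomp Require Import all_boot.
From HB Require Import structures.
From Stdlib Require Import Relation_Operators.
From mathcomp Require Import all_order all_algebra.
From mathcomp Require Import boolp classical_sets.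

Set Implicit Arguments.
Unset Strict Implicit.
Unset Printing Implicit Defensive.

Import Order.TTheory GRing.Theory Num.Theory.
Local Open Scope classical_set_scope.
Local Open Scope ring_scope.

(** * Definite values of Kleene connectives and of their finite folds *)

Lemma tv_notE x b : (tv_not x == Some b) = (x == Some (~~ b)).
Proof. by case: x b => [[]|] []. Qed.

Lemma tv_andT x y : (tv_and x y == Some true) = (x == Some true) && (y == Some true).
Proof. by case: x y => [[]|] [[]|]. Qed.

Lemma tv_andF x y :
  (tv_and x y == Some false) = (x == Some false) || (y == Some false).
Proof. by case: x y => [[]|] [[]|]. Qed.

Lemma tv_orT x y : (tv_or x y == Some true) = (x == Some true) || (y == Some true).
Proof. by case: x y => [[]|] [[]|]. Qed.

Lemma tv_orF x y :
  (tv_or x y == Some false) = (x == Some false) && (y == Some false).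
Proof. by case: x y => [[]|] [[]|]. Qed.

(** Only definite verdicts are tracked, so comparisons with [Some true] and [Some false] suffice to
    pass from Kleene to Boolean connectives. *)
Definition tvE := (tv_notE, tv_andT, tv_andF, tv_orT, tv_orF).

Section BigTv.

Variables (I : finType) (Q : pred I) (F : I -> tv).

Lemma big_tv_orT : (\big[tv_or/Some false]_(i | Q i) F i == Some true) =
  [exists (i | Q i), F i == Some true].
Proof.
by rewrite (big_morph (fun x : tv => x == Some true) tv_orT (erefl _)) big_orE.
Qed.

Lemma big_tv_orF : (\big[tv_or/Some false]_(i | Q i) F i == Some false) =
  [forall (i | Q i), F i == Some false].
Proof.
by rewrite (big_morph (fun x : tv => x == Some false) tv_orF (erefl _)) big_andE.
Qed.

Lemma big_tv_andT : (\big[tv_and/Some true]_(i | Q i) F i == Some true) =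
  [forall (i | Q i), F i == Some true].
Proof.
by rewrite (big_morph (fun x : tv => x == Some true) tv_andT (erefl _)) big_andE.
Qed.

Lemma big_tv_andF : (\big[tv_and/Some true]_(i | Q i) F i == Some false) =
  [exists (i | Q i), F i == Some false].
Proof.
by rewrite (big_morph (fun x : tv => x == Some false) tv_andF (erefl _)) big_orE.
Qed.

End BigTv.

Section TimedWords.

Variables (P : Type) (ar : P -> nat) (Reg : Type) (X : eqType) (D : Type).

Notation letter := (letter ar Reg D).
Notation tword := (tword ar Reg D).
Notation formula := (formula ar Reg X).

(** Letters contain sets and functions, so the equality test behind [\in] on observations is
    classical. *)
HB.instance Definition _ := gen_eqMixin letter.

Lemma ltr_ts (v : tword) : {mono ts v : m n / (m < n)%N >-> m < n}.
Proof.
have lt_ts := homo_ltn (@lt_trans _ rat) (ts_incr v).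
move=> m n; case: (ltngtP m n) => [/lt_ts // | /lt_ts/lt_gtF // | ->].
exact: ltxx.
Qed.

Lemma ts_inj (v : tword) : injective (ts v).
Proof.
move=> m n mn; case: (ltngtP m n) => // lt_mn;
  by move: lt_mn; rewrite -(ltr_ts v) mn ltxx.
Qed.

(** The index that [bval] chooses is forced, since timestamps increase strictly. *)
Lemma bval_ts (v : tword) (nu : X -> D) n phi :
  bval v nu (ts v n) phi = Some `[< bsem v nu n phi >].
Proof.
rewrite /bval; case: pselect => [ex|[]]; last by exists n.
by case: cid => m /= /ts_inj ->.
Qed.

(** * An invariant of reachable observations *)

Definition precedes (l l' : letter) : bool :=
  `[< forall x y, ltime l x -> ltime l' y -> x < y >].

Definition nonneg (l : letter) : bool := `[< forall x, ltime l x -> 0 <= x >].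

(** Unboundedness in the form of a final ray: letters carry arbitrary sets of times, and a ray
    yields infinitely many timestamps without any appeal to convexity. *)
Definition upward (l : letter) : bool :=
  `[< exists a, forall x, a <= x -> ltime l x >].

Arguments precedes : simpl never.
Arguments nonneg : simpl never.
Arguments upward : simpl never.

Definition wf (w : seq letter) : bool :=
  [&& all nonneg w, pairwise precedes w & has upward w].

Lemma wf_initial : wf (initial ar Reg D).
Proof.
rewrite /wf /= !andbT orbF; apply/andP; split; apply/asboolP => //=.
by exists 0.
Qed.

Lemma not_upward_bounded l : has_ubound (ltime l) -> upward l = false.
Proof.
move=> [b lb]; apply/asboolP => -[a al].
have /lb : ltime l (Num.max a b + 1).
  by apply: al; rewrite ler_wpDr // le_max lexx.
apply/negP; rewrite -ltNge.
by rewrite ltr_pwDr // le_max lexx orbT.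
Qed.

Section SplitLetter.

Variables (l : letter) (t : rat).
Hypothesis lt_ : ltime l t.

Lemma split_letter_sub l' x : l' \in split_letter l t -> ltime l' x -> ltime l x.
Proof.
move=> /mapP[A]; rewrite mem_filter !inE => /andP[_ /or3P[]/eqP-> -> /=];
  by [case | move->].
Qed.

Lemma pairwise_split_letter : pairwise precedes (split_letter l t).
Proof.
rewrite /split_letter pairwise_map; apply: pairwise_filter => /=.
rewrite !andbT -andbA.
apply/and3P; split; apply/asboolP => x y /=.
- by case=> _ xt ->.
- by case=> _ xt [_]; apply: lt_trans.
- by move=> -> [].
Qed.

Lemma upward_split_letter : upward l -> has upward (split_letter l t).
Proof.
move=> /asboolP[a al]; apply/hasP.
set A := ltime l `&` [set x | t < x].
(* The bound [t + 1] keeps the ray strictly to the right of the splitting point. *)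
have Aup x : Num.max a (t + 1) <= x -> A x.
  rewrite ge_max => /andP[ax tx]; split; first exact: al.
  by apply: lt_le_trans tx; rewrite ltrDl.
exists (Letter A (lpred l) (lreg l)); last first.
  by apply/asboolP; exists (Num.max a (t + 1)).
apply: map_f; rewrite mem_filter !inE eqxx !orbT andbT.
by apply/asboolP; exists (Num.max a (t + 1)); apply: Aup.
Qed.

End SplitLetter.

(** Common form of the three refinement steps: [s] is the list of parts, the empty list, or the same
    interval with larger maps. Times of [s] lie inside [l], so the order with all other letters is
    inherited. *)
Lemma wf_replace (w1 w2 s : seq letter) l :
  (forall l' x, l' \in s -> ltime l' x -> ltime l x) ->
  pairwise precedes s -> (upward l -> has upward s) ->
  wf (w1 ++ l :: w2) -> wf (w1 ++ s ++ w2).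
Proof.
move=> sub pws ups.
rewrite /wf !all_cat !pairwise_cat !has_cat !allrel_catr !allrel_consr /=.
move=> /and3P[/and3P[-> lge0 ->] /and3P[/andP[w1l ->] -> /andP[lw2 ->]] up].
have le_l l' l1 l2 : l' \in s -> (precedes l1 l -> precedes l1 l')
    * (precedes l l2 -> precedes l' l2).
  move=> /sub subl; split=> /asboolP lt_l; apply/asboolP => x y.
    by move=> l1x /subl; apply: lt_l.
  by move=> /subl/lt_l; apply.
rewrite pws !andbT /= -andbA; apply/and4P; split.
- apply/allP => l' l's; apply/asboolP => x /(sub _ _ l's).
  by move/asboolP: lge0; apply.
- apply/allrelP => l1 l' l1w l's; apply: (le_l l' l1 l l's).1.
  by move/allP: w1l; apply.
- apply/allrelP => l' l2 l's l2w; apply: (le_l l' l l2 l's).2.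
  by move/allP: lw2; apply.
- by case/or3P: up => [-> | /ups -> | ->]; rewrite ?orbT.
Qed.

Lemma singleton_bounded A : singleton A -> has_ubound A.
Proof. by move=> [t ->]; exists t => x ->. Qed.

Lemma wf_step w w' : step w w' -> wf w -> wf w'.
Proof.
case=> {w w'} [w1 l w2 t _ lt_ | w1 l w2 _ /not_upward_bounded l_bd |
               w1 A s r s' r' w2 /singleton_bounded A_bd _ _].
- apply: wf_replace; first exact: split_letter_sub.
    exact: pairwise_split_letter.
  exact: upward_split_letter.
(* Removed and extended letters are bounded, so the requirement to keep a final ray is vacuous for
   them. *)
- by apply: (@wf_replace _ _ [::]); rewrite ?l_bd.
- apply: (@wf_replace _ _ [:: Letter A s' r']) => [l' x | // |].
    by rewrite inE => /eqP->.
  by rewrite not_upward_bounded.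
Qed.

Lemma wf_valid (ws : nat -> seq letter) i : valid ws -> wf (ws i).
Proof.
move=> [ws0 ws_ref]; elim: i => [|i]; first by rewrite ws0 wf_initial.
have [+ _] := ws_ref i.
by elim=> [w w' /wf_step | // | w w' w'' _ IH1 _ IH2 /IH1/IH2].
Qed.

(** * Every reachable observation is refined by a timed word *)

(** Induction on [w]: a singleton letter prepends its time, any other letter without a final ray is
    skipped, and a letter with one supplies an arithmetic progression that ends the construction.
    Each timestamp is paired with its letter, from which interpretations are read off later. *)
Lemma exists_run (w : seq letter) : pairwise precedes w -> has upward w ->
  exists f : nat -> rat * letter,
  [/\ forall n, (f n).2 \in w /\ ltime (f n).2 (f n).1,
      forall n, (f n).1 < (f n.+1).1,
      forall x, exists n, x < (f n).1
    & forall l t, l \in w -> ltime l = [set t] -> exists n, (f n).1 = t].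
Proof.
elim: w => // l w IHw /= /andP[lw pw].
have [/asboolP[a al] _ | _ /= /(IHw pw)[f [fw f_incr f_nz f_sing]]] :=
  boolP (upward l).
  exists (fun n => (a + n%:R, l)); split=> [n | n | x | l' t].
  - by rewrite mem_head; split=> //; apply: al; rewrite lerDl.
  - by rewrite /= ltrD2l ltr_nat.
  - exists (Num.bound `|x - a|); rewrite /= -ltrBlDl.
    exact: le_lt_trans (ler_norm _) (archi_boundP (normr_ge0 _)).
  - rewrite inE => /predU1P[-> | l'w] lt_.
      (* A letter with a final ray contains both [a] and [a + 1], so it is no singleton. *)
      have: ltime l (a + 1) by apply: al; rewrite lerDl.
      have: ltime l a by apply: al.
      rewrite lt_ /= => -> /eqP.
      by rewrite -subr_eq0 addrAC subrr add0r oner_eq0.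
    have /asboolP lt_l := allP lw _ l'w.
    (* No singleton can follow the ray: [Num.max a t] belongs to [l] and would have to lie before
       [t]. *)
    have: Num.max a t < t.
      by apply: lt_l; [apply: al; rewrite le_max lexx | rewrite lt_].
    by rewrite ltNge le_max lexx orbT.
have [[t lt_] | nsing] := pselect (singleton (ltime l)); last first.
  exists f; split=> // [n | l' t].
    by have [fnw ?] := fw n; rewrite inE fnw orbT.
  by rewrite inE => /predU1P[-> lt_ | /f_sing]; [case: nsing; exists t | apply].
exists (fun n => if n is m.+1 then f m else (t, l)).
split=> [[|n] | [|n] | x | l' t'].
- by rewrite mem_head lt_.
- by have [fnw ?] := fw n; rewrite inE fnw orbT.
- have [f0w f0t] := fw 0%N.
  by have /asboolP lt_l := allP lw _ f0w; apply: lt_l; rewrite ?lt_.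
- exact: f_incr.
- by have [n ?] := f_nz x; exists n.+1.
- rewrite inE => /predU1P[-> | /f_sing/[apply] -[n]]; last by exists n.+1.
  by rewrite lt_ => /seteqP[/(_ t erefl) /= -> _]; exists 0%N.
Qed.

Lemma twords_of_nonempty (w : seq letter) :
  inhabited D -> wf w -> twords_of w !=set0.
Proof.
move=> [d] /and3P[ge0 pw up].
have [f [fw f_incr f_nz f_sing]] := exists_run pw up.
have f_ge0 n : 0 <= (f n).1.
  by have [/(allP ge0)/asboolP] := fw n; apply.
(* Undefined predicates default to the empty relation and undefined registers to [d]. *)
exists (TWord (fun n p => odflt set0 (lpred (f n).2 p))
              (fun n r => odflt d (lreg (f n).2 r)) f_ge0 f_incr f_nz).
split=> [n | i t].
  have [/seq_tnthP[i fni] fnt] := fw n; exists i.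
  by rewrite -fni; split=> // a b lE; rewrite /Defs.total /= lE.
by apply: f_sing; apply: mem_tnth.
Qed.

(** * The three-valued semantics approximates the Boolean one *)

Section Approximation.

Variables (w : seq letter) (v : tword).
Hypotheses (w_ord : pairwise precedes w) (wv : trefines w v).

Implicit Types (i j k : 'I_(size w)) (m n : nat) (J : itvQ).

Let L i : letter := tnth (in_tuple w) i.

(** A relation rather than a function of [i]: a nonsingleton letter may hold several positions or
    none. Conversely, a position lies in one letter only, because letters are ordered. *)
Definition located i n : Prop :=
  [/\ ltime (L i) (ts v n), pext (lpred (L i)) (Defs.total (tpred v n))
    & pext (lreg (L i)) (Defs.total (treg v n))].

Lemma precedes_tnth i k : (i < k)%N -> precedes (L i) (L k).
Proof.
move=> ik; have /(pairwiseP (L i)) nth_ord := w_ord.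
by rewrite [L k](tnth_nth (L i)) {1}/L (tnth_nth (L i)); apply: nth_ord;
  rewrite ?inE.
Qed.

Lemma located_ex n : exists i, located i n.
Proof. by have [/(_ n)[i]] := wv; exists i. Qed.

Lemma located_ltn i k m n :
  located i m -> located k n -> (i < k)%N -> (m < n)%N.
Proof.
move=> [im _ _] [kn _ _] /precedes_tnth/asboolP lt_ik.
by rewrite -(ltr_ts v); apply: lt_ik.
Qed.

Lemma located_leq i k m n :
  located i m -> located k n -> (m <= n)%N -> (i <= k)%N.
Proof.
move=> im kn mn; rewrite leqNgt; apply/negP => /(located_ltn kn im).
by rewrite ltnNge mn.
Qed.

Lemma located_singleton i m n :
  singleton (ltime (L i)) -> located i m -> located i n -> m = n.
Proof.
by move=> [t it] [im _ _] [iN _ _]; apply: (@ts_inj v); move: im iN;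
  rewrite it /= => -> ->.
Qed.

Lemma tpP i : reflect (singleton (ltime (L i))) (tp i == Some true).
Proof. by rewrite /tp; case: asboolP => ?; constructor. Qed.

(** Hence a conjunction guarded by [tp] is never false on account of the guard. *)
Lemma tp_neqF i : (tp i == Some false) = false.
Proof. by rewrite /tp; case: asboolP. Qed.

(** The second conjunct of [trefines] yields a position at time [t]; the letter that contains it
    must be [i], as two ordered letters share no time. *)
Lemma located_time i t : ltime (L i) = [set t] ->
  exists2 n, ts v n = t & located i n.
Proof.
move=> it; have [_ /(_ i t it)[n nt]] := wv; exists n => //.
have [k kn] := located_ex n; suff -> : i = k by [].
have [knt _ _] := kn.
case: (ltngtP i k) => [/precedes_tnth | /precedes_tnth | /val_inj //] /asboolP lt_.
  by have: t < ts v n by [apply: lt_ => //; rewrite it]; rewrite nt ltxx.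
by have: ts v n < t by [apply: lt_ => //; rewrite it]; rewrite nt ltxx.
Qed.

Lemma tp_located i : tp i == Some true -> exists n, located i n.
Proof. by move/tpP=> [t /located_time[n _ ?]]; exists n. Qed.

Lemma beforeT i k : (before i k == Some true) = (i < k)%N.
Proof. by rewrite /before; case: ltnP => // _; case: (_ && _). Qed.

Lemma beforeF i k m n :
  located i m -> located k n -> before i k == Some false -> (n <= m)%N.
Proof.
move=> im kn; rewrite /before; case: (ltngtP i k) => //= ik.
  by move=> _; apply: ltnW; apply: located_ltn ik.
move: kn; rewrite -(val_inj ik) eqxx => iN.
by case: asboolP => //= sing _; rewrite (located_singleton sing im iN).
Qed.

Lemma tcP J i j m n b : located i m -> located j n -> tc J i j == Some b ->
  J (ts v m - ts v n) = b :> Prop.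
Proof.
move=> [im _ _] [jn _ _]; rewrite /tc.
rewrite propeqE; case: asboolP => [inJ /eqP[<-] | _].
  by split=> // _; apply: inJ.
by case: asboolP => // ninJ /eqP[<-]; split=> // /(ninJ _ _ im jn).
Qed.

(** Otherwise the letter of position [m.+1] would have to be definitely not after [i] or not before
    [k], and [beforeF] excludes both. *)
Lemma adjacentT i k m n : located i m -> located k n ->
  (i < k)%N -> adjacent i k == Some true -> n = m.+1.
Proof.
move=> im kn ik; rewrite big_tv_andT => /forallP adj; apply/eqP.
have mn := located_ltn im kn ik.
rewrite eqn_leq mn andbT leqNgt; apply/negP => m1n.
have [j jm1] := located_ex m.+1.
have := adj j; rewrite /= !tvE /= tp_neqF /= => /orP[/beforeF | /beforeF].
  by move=> /(_ _ _ im jm1); rewrite ltnn.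
by move=> /(_ _ _ jm1 kn); rewrite leqNgt m1n.
Qed.

(** A definite refutation exhibits a singleton letter strictly between [i] and [k], hence a position
    strictly between [m] and [m.+1]. *)
Lemma adjacentF i k m : located i m -> located k m.+1 ->
  adjacent i k == Some false -> False.
Proof.
move=> im km1; rewrite big_tv_andF => /existsP[j] /=.
rewrite !tvE !beforeT => /and3P[/tp_located[n jn] ij jk].
have := located_ltn im jn ij; have := located_ltn jn km1 jk.
by rewrite ltnS leqNgt => /negP.
Qed.

Lemma pext_update (mu : X -> option D) (nu : X -> D) x (d : option D) e :
  pext mu (Defs.total nu) -> (forall d', d = Some d' -> e = d') ->
  pext (update mu x d) (Defs.total (update nu x e)).
Proof.
move=> munu de y b; rewrite /update /Defs.total.
by case: eqP => _; [move/de-> | move/munu].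
Qed.

Lemma ptuple_total (mu : X -> option D) (nu : X -> D) a (xs : a.-tuple X) ds :
  pext mu (Defs.total nu) -> ptuple mu xs = Some ds -> map_tuple nu xs = ds.
Proof.
move=> munu; rewrite /ptuple; case: pselect => // ex [<-].
apply: eq_from_tnth => k; rewrite tnth_map.
by case: cid => /= ds' /(_ k)/munu[].
Qed.

(** The induction hypothesis. It ranges over all valuations because freezing changes them, and
    equates propositions so that both verdicts are handled alike. *)
Definition approx (phi : formula) : Prop :=
  forall mu nu i n b, pext mu (Defs.total nu) -> located i n ->
    osem mu i phi == Some b -> bsem v nu n phi = b :> Prop.

Lemma approx_pred p (xs : (ar p).-tuple X) : approx (FPred Reg xs).
Proof.
move=> mu nu i n b munu [_ pred_in _] /=.
case El: (lpred _ p) => [A|] //; case Ep: (ptuple mu xs) => [ds|] // /eqP[<-].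
have [->] := pred_in _ _ El; rewrite (ptuple_total munu Ep).
by rewrite asboolE.
Qed.

Lemma approx_freeze r x phi : approx phi -> approx (FFreeze r x phi).
Proof.
move=> IH mu nu i n b munu iN /=; apply: (IH _ _ i n b) => //.
by apply: pext_update => // d'; have [_ _ /[apply] -[]] := iN.
Qed.

Lemma approx_not phi : approx phi -> approx (FNot phi).
Proof.
move=> IH mu nu i n b munu iN /=; rewrite tvE => /(IH _ _ _ _ _ munu iN)->.
by rewrite propeqE; case: b; split=> //; apply.
Qed.

Lemma approx_or phi psi : approx phi -> approx psi -> approx (FOr phi psi).
Proof.
move=> IH1 IH2 mu nu i n [] munu iN /=; rewrite tvE propeqE.
  by case/orP=> [/(IH1 _ _ _ _ _ munu iN)-> | /(IH2 _ _ _ _ _ munu iN)->];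
    split=> // _; [left | right].
by move=> /andP[/(IH1 _ _ _ _ _ munu iN)-> /(IH2 _ _ _ _ _ munu iN)->];
  split=> // -[].
Qed.

(** For a true verdict, adjacency forces the witnessing letter to hold exactly position [n.-1]. For
    a false one, the disjunct of the letter holding [n.-1] is false, and each possible cause
    contradicts the Boolean semantics. *)
Lemma approx_prev J phi : approx phi -> approx (FPrev J phi).
Proof.
move=> IH mu nu i n [] munu iN; rewrite propeqE /= ?big_tv_orT ?big_tv_orF.
  move=> /existsP[j] /=; rewrite !tvE beforeT => /and5P[jT ji adj Jij phij].
  split=> // _; have [m jm] := tp_located jT.
  have nE := adjacentT jm iN ji adj; subst n; split=> //=.
  by rewrite (tcP iN jm Jij) (IH _ _ _ _ _ munu jm phij).
move=> /forallP F; case: n iN => [|n] iN; split=> // -[] // _ [inJ phin].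
have [j jn] := located_ex n; move: (F j) => /=; rewrite !tvE tp_neqF /=.
move=> /or4P[| | /(tcP iN jn) nJ | /(IH _ _ _ _ _ munu jn) nphi].
- by move/(beforeF jn iN); rewrite ltnn.
- by move/(adjacentF jn iN).
- by rewrite nJ in inJ.
- by rewrite nphi in phin.
Qed.

Lemma approx_next J phi : approx phi -> approx (FNext J phi).
Proof.
move=> IH mu nu i n [] munu iN; rewrite propeqE /= ?big_tv_orT ?big_tv_orF.
  move=> /existsP[j] /=; rewrite !tvE beforeT => /and5P[jT ij adj Jij phij].
  split=> // _; have [m jm] := tp_located jT.
  have mE := adjacentT iN jm ij adj; subst m.
  by rewrite (tcP jm iN Jij) (IH _ _ _ _ _ munu jm phij).
move=> /forallP F; split=> // -[inJ phin].
have [j jn] := located_ex n.+1; move: (F j) => /=; rewrite !tvE tp_neqF /=.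
move=> /or4P[| | /(tcP jn iN) nJ | /(IH _ _ _ _ _ munu jn) nphi].
- by move/(beforeF iN jn); rewrite ltnn.
- by move/(adjacentF iN jn).
- by rewrite nJ in inJ.
- by rewrite nphi in phin.
Qed.

(** Letter order and position order can disagree only inside one shared letter; a singleton holds a
    single position, so there they agree. *)
Lemma located_leq_singleton i j m n : located i m -> located j n ->
  tp i == Some true \/ tp j == Some true -> (m <= n)%N = (i <= j)%N.
Proof.
move=> im jn sing; apply/idP/idP; first exact: located_leq.
rewrite leq_eqVlt => /predU1P[/val_inj E | /(located_ltn im jn)/ltnW //].
subst j; suff /tpP/located_singleton/(_ im jn)-> : tp i == Some true by [].
by case: sing.
Qed.

(** A true verdict names a singleton letter, whose position is the Boolean witness. A false one is
    tested at the letter of a supposed Boolean witness. *)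
Lemma approx_since J phi psi :
  approx phi -> approx psi -> approx (FSince J phi psi).
Proof.
move=> IH1 IH2 mu nu i n [] munu iN; rewrite propeqE /= ?big_tv_orT ?big_tv_orF.
  move=> /existsP[j] /=; rewrite !tvE big_tv_andT.
  move=> /and5P[ji jT Jij psij /forallP phik].
  split=> // _; have [m jm] := tp_located jT; exists m; split.
  - by rewrite (located_leq_singleton jm iN) ?jT //; left.
  - by rewrite (tcP iN jm Jij).
  - by rewrite (IH2 _ _ _ _ _ munu jm psij).
  - move=> q /andP[mq qn]; have [k kq] := located_ex q.
    (* Strictness survives because [j] is a singleton: a position after [m] cannot share its
       letter. *)
    have jk : (j < k)%N.
      by rewrite ltnNge -(located_leq_singleton kq jm) -?ltnNge //; right.
    have := phik k; rewrite /= jk (located_leq kq iN qn) !tvE tp_neqF /=.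
    by move/(IH1 _ _ _ _ _ munu kq)->.
move=> /forallP F; split=> // -[m [mn inJ psim phiq]].
have [j jm] := located_ex m; move: (F j) => /=.
rewrite (located_leq jm iN mn) /= !tvE big_tv_andF tp_neqF /=.
move=> /or3P[/(tcP iN jm) nJ | /(IH2 _ _ _ _ _ munu jm) npsi | ].
- by rewrite nJ in inJ.
- by rewrite npsi in psim.
move=> /existsP[k] /=; rewrite !tvE => /andP[/andP[jk ki] /andP[kT phik]].
(* The implication is false only if [k] surely holds a time point, so the failure of [phi] occurs at
   an actual position. *)
have [q kq] := tp_located kT.
have : bsem v nu q phi.
  apply: phiq; rewrite (located_ltn jm kq jk).
  by rewrite (located_leq_singleton kq iN) //; left.
by rewrite (IH1 _ _ _ _ _ munu kq phik).
Qed.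

Lemma approx_until J phi psi :
  approx phi -> approx psi -> approx (FUntil J phi psi).
Proof.
move=> IH1 IH2 mu nu i n [] munu iN; rewrite propeqE /= ?big_tv_orT ?big_tv_orF.
  move=> /existsP[j] /=; rewrite !tvE big_tv_andT.
  move=> /and5P[ij jT Jij psij /forallP phik].
  split=> // _; have [m jm] := tp_located jT; exists m; split.
  - by rewrite (located_leq_singleton iN jm) ?jT //; right.
  - by rewrite (tcP jm iN Jij).
  - by rewrite (IH2 _ _ _ _ _ munu jm psij).
  - move=> q /andP[nq qm]; have [k kq] := located_ex q.
    have kj : (k < j)%N.
      by rewrite ltnNge -(located_leq_singleton jm kq) -?ltnNge //; left.
    have := phik k; rewrite /= kj (located_leq iN kq nq) !tvE tp_neqF /=.
    by move/(IH1 _ _ _ _ _ munu kq)->.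
move=> /forallP F; split=> // -[m [nm inJ psim phiq]].
have [j jm] := located_ex m; move: (F j) => /=.
rewrite (located_leq iN jm nm) /= !tvE big_tv_andF tp_neqF /=.
move=> /or3P[/(tcP jm iN) nJ | /(IH2 _ _ _ _ _ munu jm) npsi | ].
- by rewrite nJ in inJ.
- by rewrite npsi in psim.
move=> /existsP[k] /=; rewrite !tvE => /andP[/andP[ik kj] /andP[kT phik]].
have [q kq] := tp_located kT.
have : bsem v nu q phi.
  apply: phiq; rewrite (located_ltn kq jm kj) andbT.
  by rewrite (located_leq_singleton iN kq) //; right.
by rewrite (IH1 _ _ _ _ _ munu kq phik).
Qed.

Lemma osem_approx phi : approx phi.
Proof.
elim: phi => [|p xs|r x phi|phi|phi IH1 psi|J phi|J phi|J phi IH1 psi|J phi IH1 psi].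
- by move=> mu nu i n b _ _ /eqP[<-]; rewrite propeqE.
- exact: approx_pred.
- exact: approx_freeze.
- exact: approx_not.
- exact: approx_or.
- exact: approx_prev.
- exact: approx_next.
- exact: approx_since.
- exact: approx_until.
Qed.

Lemma oval_bval mu (nu : X -> D) t phi b : pext mu (Defs.total nu) ->
  oval w mu t phi = Some b -> bval v nu t phi = Some b.
Proof.
move=> munu; rewrite /oval; case: pickP => // i /asboolP/located_time[n <- iN].
move=> /eqP/(osem_approx munu iN) phiE.
by rewrite bval_ts phiE asboolb.
Qed.

End Approximation.

(** * From definite observational verdicts to meets *)

Lemma infimum_bval mu (nu : X -> D) t (phi : formula) (w : seq letter) b :
  inhabited D -> wf w -> pext mu (Defs.total nu) -> oval w mu t phi = Some b ->
  infimums [set bval v nu t phi | v in twords_of w] (Some b).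
Proof.
move=> Dinh wf_w munu ob; have [_ w_ord _] := and3P wf_w.
have bvalE v : twords_of w v -> bval v nu t phi = Some b.
  by move=> wv; apply: oval_bval ob.
split=> [_ [v wv <-] | x lbx]; first by rewrite bvalE.
(* An actual member of the set is what bounds every other lower bound. *)
have [v wv] := twords_of_nonempty Dinh wf_w.
by rewrite -(bvalE v wv); apply: lbx; exists v.
Qed.

End TimedWords.

Theorem theorem3p12 (P : Type) (ar : P -> nat) (Reg : Type) (X : eqType)
    (D : Type) (D_inhabited : inhabited D) (M : @monitor P ar Reg X D) :
  (monitor_has (@obs_sound P ar Reg X D) M ->
   monitor_has (@sound P ar Reg X D) M) /\
  (monitor_has (@complete P ar Reg X D) M ->
   monitor_has (@obs_complete P ar Reg X D) M).
Proof.
split=> [os | comp] phi ws clo val_ws.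
  (* Observational soundness is applied to the total valuation viewed as a partial one. *)
  move=> nu i t b /(os _ _ clo val_ws (Defs.total nu)).
  by apply: infimum_bval => //; apply: wf_valid.
move=> mu i t t_ge0 [c muc]; have [d] := D_inhabited.
(* Completeness needs a total valuation: [mu] is completed with the default [d], and the definite
   verdict carries over to this extension. *)
apply: (comp _ _ clo val_ws (fun x => odflt d (mu x))) => //.
exists c; apply: infimum_bval muc => //; first exact: wf_valid.
by move=> x e; rewrite /Defs.total => ->.
Qed.
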